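(* Let $A_1,\dots,A_m\subset\mathbb{F}_q$ be non-empty subsets with $|A_i|=d_i$ and $d_1\le\dots\le d_m$, let $\mathcal{A}=A_1\times\cdots\times A_m$, and let $d$ be a positive integer with $d\le k:=\sum_{i=1}^m(d_i-1)$. Then, for every $1\le r\le\dim AC_q(d,\mathcal{A})^\perp$, the $r$-th generalized Hamming weight of the code $AC_q(d,\mathcal{A})^\perp$ is given by $d_r(k-d-1,\mathcal{A})$, the $r$-th generalized Hamming weight of $AC_q(k-d-1,\mathcal{A})$.
   Context: $\mathbb{F}_q$ is the finite field with $q$ elements. Put $n=|\mathcal{A}|=d_1\cdots d_m$ and fix an enumeration $P_1,\dots,P_n$ of $\mathcal{A}$. For an integer $e\le k$, $S_{\le e}(\mathcal{A})$ is the $\mathbb{F}_q$-vector space of polynomials $f\in\mathbb{F}_q[x_1,\dots,x_m]$ of total degree at most $e$ with $\deg_{x_i}f<d_i$ for all $i$ (it is $\{0\}$ if $e<0$). The affine cartesian code is $AC_q(e,\mathcal{A})=\{(f(P_1),\dots,f(P_n)):f\in S_{\le e}(\mathcal{A})\}\subseteq\mathbb{F}_q^n$. For a linear code $C\subseteq\mathbb{F}_q^N$, the dual code is $C^\perp=\{(e_1,\dots,e_N)\in\mathbb{F}_q^N:c_1e_1+\cdots+c_Ne_N=0\text{ for all }(c_1,\dots,c_N)\in C\}$. For a linear subspace $D\subseteq\mathbb{F}_q^N$, $\mathrm{Supp}(D)=\{i:\text{there exists }(c_1,\dots,c_N)\in D\text{ with }c_i\ne0\}$. For a linear code $C\subseteq\mathbb{F}_q^N$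 of dimension $K$ and $1\le r\le K$, the $r$-th generalized Hamming weight of $C$ is $d_r(C)=\min\{|\mathrm{Supp}(D)|:D\subseteq C\text{ a linear subspace},\ \dim D=r\}$. One writes $d_r(e,\mathcal{A})=d_r(AC_q(e,\mathcal{A}))$. *)

(* Defs.v *)
From HB Require Import structures.
From mathcomp Require Import all_boot all_order all_algebra.
From mathcomp Require Import boolp.
From mathcomp Require Import mpoly.

Set Implicit Arguments.
Unset Strict Implicit.
Unset Printing Implicit Defensive.

Import Order.TTheory GRing.Theory Num.Theory.
Local Open Scope ring_scope.

(* Exposes the embedding of {vspace _} into matrices, for the instances below. *)
Import VectorInternalTheory.

(* Over a finite field, F^n has finitely many subspaces; this lets minima      *)
(* range over {vspace 'rV[F]_n}.                                               *)
HB.instance Definition _ (F : finFieldType) (n : nat) :=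
  [Countable of {vspace 'rV[F]_n} by <:].
HB.instance Definition _ (F : finFieldType) (n : nat) :=
  [Finite of {vspace 'rV[F]_n} by <:].

Section Codes.
Variables (F : finFieldType) (n : nat).

(* Packages a set of words that is already closed under linear combinations    *)
(* as a subspace; see mem_vspace_of.                                           *)
Definition vspace_of (X : {set 'rV[F]_n}) : {vspace 'rV[F]_n} :=
  <<enum X>>%VS.

Lemma mem_vspace_of (X : {set 'rV[F]_n}) :
  0 \in X -> (forall a u v, u \in X -> v \in X -> a *: u + v \in X) ->
  vspace_of X =i X.
Proof.
move=> X0 XL v; apply/idP/idP => [|vX]; last first.
  by apply: memv_span; rewrite mem_enum.
move=> /coord_span ->; apply: (big_ind (fun w => w \in X)) => //.
  by move=> x y xX yX; rewrite -[x]scale1r; apply: XL.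
move=> i _; rewrite -[_ *: _]addr0; apply: XL => //.
by rewrite -mem_enum; apply: mem_nth; rewrite -cardE; apply: ltn_ord.
Qed.

Definition dual_code (C : {vspace 'rV[F]_n}) : {vspace 'rV[F]_n} :=
  vspace_of [set e : 'rV[F]_n |
    [forall c : 'rV[F]_n, (c \in C) ==> (\sum_(j < n) c 0 j * e 0 j == 0)]].

Lemma mem_dual_code (C : {vspace 'rV[F]_n}) (e : 'rV[F]_n) :
  reflect (forall c, c \in C -> \sum_(j < n) c 0 j * e 0 j = 0)
          (e \in dual_code C).
Proof.
rewrite mem_vspace_of ?inE.
- apply: (iffP forallP) => H c; first by move=> cC; apply/eqP/(implyP (H c)).
  by apply/implyP => cC; apply/eqP/H.
- apply/forallP => c; apply/implyP => _; apply/eqP.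
  by apply: big1 => j _; rewrite mxE mulr0.
- move=> a u v; rewrite !inE => /forallP uX /forallP vX.
  apply/forallP => c; apply/implyP => cC.
  have -> : \sum_(j < n) c 0 j * (a *: u + v) 0 j =
      a * (\sum_(j < n) c 0 j * u 0 j) + \sum_(j < n) c 0 j * v 0 j.
    rewrite mulr_sumr -big_split /=; apply: eq_bigr => j _.
    by rewrite !mxE mulrDr mulrCA.
  rewrite (eqP (implyP (uX c) cC)) (eqP (implyP (vX c) cC)).
  by rewrite mulr0 addr0.
Qed.

Definition supp_code (D : {vspace 'rV[F]_n}) : {set 'I_n} :=
  [set i | [exists c : 'rV[F]_n, (c \in D) && (c 0 i != 0)]].

(* The value is n.+1, which is not the size of any support, when C has no      *)
(* r-dimensional subspace. An equality of weights whose left-hand side is      *)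
(* meaningful thus entails that its right-hand side is too.                    *)
Definition ghw (r : nat) (C : {vspace 'rV[F]_n}) : nat :=
  \big[minn/n.+1]_(D : {vspace 'rV[F]_n} | (D <= C)%VS && (\dim D == r))
    #|supp_code D|.

Lemma ghw_le (r : nat) (C D : {vspace 'rV[F]_n}) :
  (D <= C)%VS -> \dim D = r -> (ghw r C <= #|supp_code D|)%N.
Proof.
move=> DC Dr; rewrite /ghw -minEnat -leEnat.
by apply: bigmin_le_cond; rewrite DC Dr eqxx.
Qed.

Lemma ghw_attained (r : nat) (C : {vspace 'rV[F]_n}) :
  (r <= \dim C)%N ->
  exists D, [/\ (D <= C)%VS, \dim D = r & #|supp_code D| = ghw r C].
Proof.
move=> rC.
have [D0 [D0C D0r]] : exists D0, (D0 <= C)%VS /\ \dim D0 = r.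
  have fC := basis_free (vbasisP C).
  exists <<take r (vbasis C)>>%VS; split.
    rewrite -[X in (_ <= X)%VS](span_basis (vbasisP C)).
    by apply: sub_span => x /mem_take.
  have fT : free (take r (vbasis C)).
    by apply: (@catl_free _ _ (drop r (vbasis C))); rewrite cat_take_drop.
  move: fT; rewrite /free => /eqP ->.
  by rewrite size_take size_tuple; case: ltngtP rC.
have : (ghw r C <= n)%N.
  by apply: leq_trans (ghw_le D0C D0r) _; rewrite -[X in (_ <= X)%N]card_ord max_card.
rewrite /ghw; elim/big_ind: _ => [|x y IHx IHy|D /andP[DC /eqP Dr] _].
- by rewrite ltnn.
- by rewrite /minn; case: ifP.
- by exists D.
Qed.

End Codes.

Section AffineCartesian.
Variables (F : finFieldType) (m : nat) (A : 'I_m -> {set F}).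

Definition cart : {set {ffun 'I_m -> F}} :=
  [set x : {ffun _ -> _} | [forall i, x i \in A i]].

(* The degree conditions are imposed on each monomial of f with nonzero        *)
(* coefficient, so that the zero polynomial has degree -oo.                    *)
Definition in_Sle (e : int) (f : {mpoly F[m]}) : bool :=
  all (fun u : 'X_{1..m} =>
         ((mdeg u)%:Z <= e) && [forall i, (u i < #|A i|)%N]) (msupp f).

Definition eval_word (n : nat) (P : n.-tuple {ffun 'I_m -> F})
    (f : {mpoly F[m]}) : 'rV[F]_n :=
  \row_(j < n) f.@[tnth P j].

Definition AC_code (n : nat) (P : n.-tuple {ffun 'I_m -> F}) (e : int) :
    {vspace 'rV[F]_n} :=
  vspace_of [set c | `[< exists2 f, in_Sle e f & c = eval_word P f >]].

Lemma mem_AC_code (n : nat) (P : n.-tuple {ffun 'I_m -> F}) (e : int) c :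
  c \in AC_code P e <-> exists2 f, in_Sle e f & c = eval_word P f.
Proof.
rewrite mem_vspace_of ?inE; first by apply: iff_sym; apply: rwP; apply: asboolP.
- apply/asboolP; exists 0; first by rewrite /in_Sle msupp0.
  by apply/rowP => j; rewrite !mxE meval0.
- move=> a u v; rewrite !inE => /asboolP[f fS ->] /asboolP[g gS ->].
  apply/asboolP; exists (a *: f + g); last first.
    by apply/rowP => j; rewrite !mxE mevalD mevalZ.
  apply/allP => w /msuppD_le; rewrite mem_cat => /orP[/msuppZ_le|].
    exact: (allP fS).
  exact: (allP gS).
Qed.

End AffineCartesian.

(* Main.v *)
Require Import Defs.
From mathcomp Require Import all_boot all_order all_algebra.
From mathcomp Require Import mpoly zify.

Set Implicit Arguments.
Unset Strict Implicit.
Unset Printing Implicit Defensive.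

Import Order.TTheory.
Import GRing.Theory Num.Theory.
Local Open Scope ring_scope.

(** Write [d_i] for the size of [A_i].  The dual of the code of degree [d] is
    the code of degree [k - d - 1] with each coordinate rescaled by a nonzero
    constant.  Such a rescaling maps subspaces to subspaces of the same
    dimension and the same support, so it preserves all generalized Hamming
    weights ([ghw_diag]), and the theorem follows.

    The scaling factor at a point [x] of the product is the product over [i] of
    the leading coefficients [w_i(x_i)] of the Lagrange basis polynomials of
    [A_i] at [x_i].  Reading off the coefficient of degree [d_i - 1] in the
    interpolation formula for [X^s] shows that the sum over [a] in [A_i] of
    [w_i(a) a^s] is 0 for [s < d_i - 1] and 1 for [s = d_i - 1]
    ([lagrange_weight_moment]).  By distributivity the weighted sum of a
    monomial over the product of the [A_i] is the product of such univariate
    moments.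

    A monomial of total degree below [k] has some exponent below [d_i - 1], so
    its weighted sum vanishes; a product of reduced polynomials of degrees at
    most [k - d - 1] and [d] has only such monomials, whence the rescaled code
    lies in the dual.  Conversely, by interpolation every word is the evaluation
    of a reduced polynomial [f].  If [f] had degree at least [k - d], take a
    monomial [u] of [f] of maximal degree and let [v] be its complement,
    [v_i = d_i - 1 - u_i], of degree at most [d].  In [f * X^v] only the monomial
    coming from [u] has a nonzero moment, so the weighted sum of [f * X^v] is the
    coefficient of [u] in [f] ([top_degree_pairing]), which is not zero, and the
    rescaled word is not in the dual. *)

(** * Univariate interpolation on a finite set *)

Definition lagrange_poly (F : finFieldType) (B : {set F}) (a : F) : {poly F} :=
  \prod_(b in B :\ a) ((a - b)^-1 *: ('X - b%:P)).

Lemma horner_lagrange_poly (F : finFieldType) (B : {set F}) (a b : F) :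
  b \in B -> (lagrange_poly B a).[b] = (b == a)%:R.
Proof.
move=> bB; rewrite /lagrange_poly horner_prod; case: eqP => [->|/eqP ba].
  apply: big1 => x; rewrite !inE => /andP[xa _].
  by rewrite hornerZ hornerXsubC mulVf // subr_eq0 eq_sym.
by rewrite (bigD1 b) ?inE ?ba //= hornerZ hornerXsubC subrr mulr0 mul0r.
Qed.

Lemma size_lagrange_poly (F : finFieldType) (B : {set F}) (a : F) :
  a \in B -> size (lagrange_poly B a) = #|B|.
Proof.
move=> aB; rewrite /lagrange_poly scaler_prod size_scale; last first.
  apply/prodf_neq0 => b; rewrite !inE => /andP[ba _].
  by rewrite invr_neq0 // subr_eq0 eq_sym.
by rewrite -big_enum size_prod_XsubC -cardE [in RHS](cardsD1 a) aB.
Qed.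

Lemma lagrange_interpolation (F : finFieldType) (B : {set F}) (p : {poly F}) :
  (size p <= #|B|)%N -> p = \sum_(a in B) p.[a] *: lagrange_poly B a.
Proof.
move=> szp; apply/eqP; rewrite -subr_eq0; apply/eqP.
apply: (@roots_geq_poly_eq0 _ _ (enum B)); last 2 first.
- by rewrite enum_uniq.
- rewrite -cardE; apply: leq_trans (size_polyD _ _) _.
  rewrite geq_max szp size_polyN; apply: leq_trans (size_sum _ _ _) _.
  apply/bigmax_leqP => a aB; apply: leq_trans (size_scale_leq _ _) _.
  by rewrite size_lagrange_poly.
apply/allP => b; rewrite mem_enum => bB; apply/rootP.
rewrite hornerD hornerN horner_sum (bigD1 b) //= hornerZ.
rewrite horner_lagrange_poly // eqxx mulr1 big1 ?addr0 ?subrr // => a /andP[_ ab].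
by rewrite hornerZ horner_lagrange_poly // eq_sym (negbTE ab) mulr0.
Qed.

(** For [a] in [B] this is the inverse of the product of [a - b] over the other
    points [b] of [B]; the form as a coefficient is the one that the moment
    computation uses. *)
Definition lagrange_weight (F : finFieldType) (B : {set F}) (a : F) : F :=
  (lagrange_poly B a)`_(#|B| - 1).

Lemma lagrange_weight_neq0 (F : finFieldType) (B : {set F}) (a : F) :
  a \in B -> lagrange_weight B a != 0.
Proof.
move=> aB; have sz := size_lagrange_poly aB.
rewrite /lagrange_weight -sz subn1 -/(lead_coef _) lead_coef_eq0 -size_poly_eq0 sz.
by rewrite cards_eq0; apply/set0Pn; exists a.
Qed.

(** Compare the coefficients of degree [#|B| - 1] in the interpolation formula
    for ['X^s]. *)
Lemma lagrange_weight_moment (F : finFieldType) (B : {set F}) (s : nat) :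
  (s < #|B|)%N ->
  \sum_(a in B) lagrange_weight B a * a ^+ s = (s == #|B| - 1)%N%:R.
Proof.
move=> sB; rewrite eq_sym -coefXn.
rewrite [in RHS](@lagrange_interpolation _ B 'X^s) ?size_polyXn // coef_sum.
by apply: eq_bigr => a _; rewrite coefZ hornerXn mulrC.
Qed.

(** * Invariance of generalized Hamming weights under coordinate scaling *)

(** An inequality rather than an equality, so that [ghw_diag] results from using
    it with [w] and with the inverse of [w].  It also holds when [C] has no
    subspace of dimension [r]: then the right-hand side is the default [n.+1]. *)
Lemma ghw_diag_le (F : finFieldType) (n r : nat) (w : 'rV[F]_n)
    (C C' : {vspace 'rV[F]_n}) :
  (forall j, w 0 j != 0) -> (forall c, c \in C -> c *m diag_mx w \in C') ->
  (ghw r C' <= ghw r C)%N.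
Proof.
move=> w0 CC'.
pose f : 'End('rV[F]_n) := linfun (mulmxr (diag_mx w)).
have fE c j : f c 0 j = c 0 j * w 0 j by rewrite lfunE /= mul_mx_diag mxE.
have kf : lker f = 0%VS.
  apply/eqP; rewrite -subv0; apply/subvP => c; rewrite memv_ker => /eqP fc0.
  rewrite memv0; apply/eqP/rowP => j; move/rowP/(_ j)/eqP: fc0.
  by rewrite fE !mxE mulf_eq0 (negbTE (w0 j)) orbF => /eqP.
rewrite {2}/ghw.
elim/big_ind: _ => [|x y hx hy|D /andP[DC /eqP Dr]].
- rewrite /ghw -minEnat -leEnat; exact: Order.TotalTheory.bigmin_le_id.
- by rewrite leq_min hx.
have -> : supp_code D = supp_code (f @: D).
  apply/setP => j; rewrite !inE; apply/existsP/existsP => -[c /andP[cD cj]].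
    by exists (f c); rewrite memv_img //= fE mulf_neq0.
  have [c0 c0D cE] := memv_imgP cD; exists c0; rewrite c0D.
  by apply: contraNneq cj => c0j; rewrite cE fE c0j mul0r.
apply: ghw_le; last by rewrite limg_dim_eq // kf capv0.
by apply/subvP => _ /memv_imgP[c cD ->]; rewrite lfunE /=; apply/CC'/(subvP DC).
Qed.

Lemma ghw_diag (F : finFieldType) (n r : nat) (w : 'rV[F]_n)
    (C C' : {vspace 'rV[F]_n}) :
  (forall j, w 0 j != 0) -> (forall c, (c *m diag_mx w \in C') = (c \in C)) ->
  ghw r C' = ghw r C.
Proof.
move=> w0 CC'; apply/eqP; rewrite eqn_leq; apply/andP; split.
  by apply: (@ghw_diag_le _ _ _ w) => // c; rewrite CC'.
apply: (@ghw_diag_le _ _ _ (\row_j (w 0 j)^-1)) => [j|c cC'].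
  by rewrite mxE invr_neq0.
rewrite -CC'; suff -> : c *m diag_mx (\row_j (w 0 j)^-1) *m diag_mx w = c by [].
apply/rowP => j.
by rewrite !mul_mx_diag !mxE mulfVK.
Qed.

(** * Weighted sums over a cartesian product *)

Section CartesianWeights.
Variables (F : finFieldType) (m : nat) (A : 'I_m -> {set F}).

Definition cart_weight (x : 'I_m -> F) : F := \prod_i lagrange_weight (A i) (x i).

Definition cart_moment (t : 'X_{1..m}) : F :=
  \prod_i \sum_(a in A i) lagrange_weight (A i) a * a ^+ t i.

Lemma sum_cart_prod (G : 'I_m -> F -> F) :
  \sum_(x in cart A) \prod_i G i (x i) = \prod_i \sum_(a in A i) G i a.
Proof.
rewrite (bigA_distr_big_dep (fun i => mem (A i))); apply: eq_bigl => x; rewrite inE.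
by apply/forallP/familyP.
Qed.

Lemma sum_cart_weight_meval (h : {mpoly F[m]}) :
  \sum_(x in cart A) cart_weight x * h.@[x] =
  \sum_(t <- msupp h) h@_t * cart_moment t.
Proof.
under eq_bigr do rewrite mevalE mulr_sumr.
rewrite exchange_big; apply: eq_bigr => t _ /=.
rewrite /cart_moment -sum_cart_prod mulr_sumr; apply: eq_bigr => x _.
by rewrite mulrCA -big_split.
Qed.

(** One vanishing factor suffices, so exponents of [t] outside the range of
    [lagrange_weight_moment] do no harm. *)
Lemma cart_moment_eq0 (t : 'X_{1..m}) :
  (exists i, (t i < #|A i| - 1)%N) -> cart_moment t = 0.
Proof.
move=> [i ti]; rewrite /cart_moment (bigD1 i) //= lagrange_weight_moment.
  by rewrite (ltn_eqF ti) mul0r.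
by apply: leq_trans ti (leq_subr _ _).
Qed.

Lemma cart_moment_corner (t : 'X_{1..m}) :
  (forall i, A i != set0) -> (forall i, t i = #|A i| - 1)%N -> cart_moment t = 1.
Proof.
move=> A0 tE; apply: big1 => i _; rewrite lagrange_weight_moment tE ?eqxx //.
by rewrite ltn_subrL /= card_gt0.
Qed.

(** If all exponents of a monomial were at least [#|A i| - 1], its degree would
    be at least the sum of these numbers. *)
Lemma sum_cart_weight_low_degree (h : {mpoly F[m]}) :
  (forall t, t \in msupp h -> (mdeg t < \sum_i (#|A i| - 1))%N) ->
  \sum_(x in cart A) cart_weight x * h.@[x] = 0.
Proof.
move=> hdeg; rewrite sum_cart_weight_meval big_seq; apply: big1 => t /hdeg tk.
rewrite cart_moment_eq0 ?mulr0 //; apply/existsP; apply: contraLR tk.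
rewrite negb_exists -leqNgt mdegE => /forallP tA; apply: leq_sum => i _.
by rewrite leqNgt.
Qed.

(** A monomial [t] of [f] other than [u] cannot dominate [u] exponentwise,
    because its degree does not exceed that of [u]; so some exponent of [t + v]
    is below that of [u + v], which is the corner [#|A i| - 1], and its moment
    vanishes. *)
Lemma top_degree_pairing (f : {mpoly F[m]}) (u v : 'X_{1..m}) :
  (forall i, A i != set0) ->
  (forall i, u i + v i = #|A i| - 1)%N ->
  (forall t, t \in msupp f -> (mdeg t <= mdeg u)%N) ->
  \sum_(x in cart A) cart_weight x * (f * 'X_[v]).@[x] = f@_u.
Proof.
move=> A0 uv umax.
have -> : f * 'X_[v] = \sum_(t <- msupp f) f@_t *: 'X_[t + v].
  rewrite [in LHS](mpolyE f) mulr_suml; apply: eq_bigr => t _.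
  by rewrite -scalerAl mpolyXD.
have mono t : \sum_(x in cart A) cart_weight x * ('X_[t + v] : {mpoly F[m]}).@[x] =
    cart_moment (t + v).
  by rewrite sum_cart_weight_meval msuppX big_seq1 mcoeffX eqxx mul1r.
transitivity (\sum_(t <- msupp f) f@_t * cart_moment (t + v)).
  under [in RHS]eq_bigr do rewrite -mono mulr_sumr.
  rewrite exchange_big; apply: eq_bigr => x _ /=.
  rewrite raddf_sum mulr_sumr; apply: eq_bigr => t _ /=.
  by rewrite mevalZ mulrCA.
have other t : t \in msupp f -> t != u -> cart_moment (t + v) = 0.
  move=> tf tu; apply: cart_moment_eq0; apply/existsP.
  apply: contraNT tu; rewrite negb_exists => /forallP tv.
  have le i : (u i <= t i)%N.
    by move: (tv i); rewrite -leqNgt mnmDE -uv leq_add2r.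
  have := umax t tf; rewrite !mdegE => tsum; apply/eqP/mnmP => i.
  have /leqif_sum := fun i (_ : true) => leqif_eq (le i).
  move=> [_]; rewrite eqn_leq tsum leq_sum //= => /esym/forallP/(_ i)/eqP ->.
  by [].
have corner : cart_moment (u + v) = 1.
  by apply: cart_moment_corner => // i; rewrite mnmDE.
have [uf|uf] := boolP (u \in msupp f).
  rewrite (bigD1_seq u) ?msupp_uniq //= corner mulr1 big_seq_cond big1 ?addr0 //.
  by move=> t /andP[tf tu]; rewrite other ?mulr0.
rewrite (memN_msupp_eq0 uf) big_seq big1 // => t tf; rewrite other ?mulr0 //.
by apply: contraNneq uf => <-.
Qed.

Lemma cart_weight_neq0 x : x \in cart A -> cart_weight x != 0.
Proof.
rewrite inE => /forallP xA; apply/prodf_neq0 => i _.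
exact: lagrange_weight_neq0.
Qed.

End CartesianWeights.

(** * The dual of an affine cartesian code *)

Section CodeOfCart.
Variables (F : finFieldType) (m : nat) (A : 'I_m -> {set F}).
Variables (n : nat) (P : n.-tuple {ffun 'I_m -> F}).
Hypotheses (P_uniq : uniq P) (P_enum : P =i cart A).

Lemma sum_points (G : {ffun 'I_m -> F} -> F) :
  \sum_(j < n) G (tnth P j) = \sum_(x in cart A) G x.
Proof.
rewrite -(eq_bigl _ _ P_enum) -big_uniq //=.
by rewrite big_tuple.
Qed.

Lemma in_SleP (e : int) (f : {mpoly F[m]}) :
  reflect (forall u, u \in msupp f ->
             (mdeg u)%:Z <= e /\ forall i, (u i < #|A i|)%N)
          (in_Sle A e f).
Proof.
by apply: (iffP allP) => H u /H; [move=> /andP[? /forallP]|move=> [? /forallP ?]; apply/andP].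
Qed.

(** Interpolation: the products over [i] of the Lagrange polynomials of [A i] at
    the coordinates of a point evaluate to the unit vectors.  These products are
    handled through their expansion into monomials, so that membership in the
    code only has to be checked for monomials. *)
Lemma AC_code_full c :
  c \in AC_code A P (\sum_i (#|A i| - 1))%N%:Z.
Proof.
set e := _%:Z.
have monoP (u : {ffun 'I_m -> 'I_#|F|.+1}) : (forall i, u i < #|A i|)%N ->
    eval_word P 'X_[[multinom (u i : nat) | i < m]] \in AC_code A P e.
  move=> uA; apply/mem_AC_code; eexists; last by [].
  apply/in_SleP => t; rewrite msuppX inE => /eqP ->; split=> [|i]; last by rewrite mnmE.
  rewrite lez_nat mdegE; apply: leq_sum => i _; rewrite mnmE -ltnS.
  by apply: leq_trans (uA i) _; rewrite subn1 leqSpred.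
(* [g a u] is the coefficient of the monomial [u] in the product of the
   Lagrange polynomials at [a].  The exponent bound [#|F|] is uniform in [i];
   the coefficients beyond [#|A i|] are zero. *)
pose g (a : {ffun 'I_m -> F}) (u : {ffun 'I_m -> 'I_#|F|.+1}) : F :=
  \prod_i (lagrange_poly (A i) (a i))`_(u i).
have PA j i : tnth P j i \in A i.
  by have := mem_tnth j P; rewrite P_enum inE => /forallP.
have -> : c = \sum_(l < n) c 0 l *: \sum_u g (tnth P l) u *:
                eval_word P 'X_[[multinom (u i : nat) | i < m]].
  apply/rowP => j; rewrite summxE.
  have ev l : (\sum_u g (tnth P l) u *:
      eval_word P 'X_[[multinom (u i : nat) | i < m]]) 0 j = (j == l)%:R.
    rewrite summxE.
    transitivity (\prod_i \sum_(s < #|F|.+1)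
        (lagrange_poly (A i) (tnth P l i))`_s * tnth P j i ^+ s).
      rewrite bigA_distr_bigA; apply: eq_bigr => u _.
      rewrite !mxE mevalX /g -big_split; apply: eq_bigr => i _ /=.
      by rewrite mnmE.
    have -> : (j == l) = [forall i, tnth P j i == tnth P l i].
      apply/eqP/forallP => [-> //|H]; have : tnth P j = tnth P l.
        by apply/ffunP => i; apply/eqP.
      by move/tuple_uniqP: P_uniq; apply.
    under eq_bigr => i _.
      rewrite -(@horner_coef_wide _ #|F|.+1); last first.
        by rewrite size_lagrange_poly // (leq_trans (max_card _)).
      rewrite horner_lagrange_poly //; over.
    case: forallP => [H|/forallP]; first by rewrite big1 // => i _; rewrite H.
    by rewrite negb_forall => /existsP[i /negbTE H]; rewrite (bigD1 i) //= H mul0r.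
  rewrite (bigD1 j) //= mxE ev eqxx mulr1 big1 ?addr0 // => l /negbTE lj.
  by rewrite mxE ev eq_sym lj mulr0.
apply: memv_suml => l _; apply: memvZ; apply: memv_suml => u _.
have [|/forallP uA] := boolP [forall i, u i < #|A i|]%N.
  by move/forallP => uA; apply/memvZ/monoP.
have [i uiA] : exists i, (#|A i| <= u i)%N.
  by apply/existsP; move/forallP: uA; rewrite negb_forall; under eq_existsb do rewrite -leqNgt.
rewrite /g (bigD1 i) //= nth_default ?mul0r ?scale0r ?mem0v //.
by rewrite size_lagrange_poly.
Qed.

(** From right to left every monomial of the product has degree below [k]; from
    left to right the word is tested against the complement of a monomial of
    top degree.  The degree on the right is an integer: when it is negative,
    both codes consist of the zero word. *)
Lemma AC_code_dual (d : nat) (c : 'rV[F]_n) :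
  (forall i, A i != set0) ->
  (c *m diag_mx (\row_j cart_weight A (tnth P j)) \in dual_code (AC_code A P d%:Z)) =
  (c \in AC_code A P ((\sum_i (#|A i| - 1))%N%:Z - d%:Z - 1)).
Proof.
move=> A0; set k := (\sum_i _)%N.
have pairE f g : c = eval_word P f ->
    \sum_(j < n) eval_word P g 0 j *
      (c *m diag_mx (\row_j cart_weight A (tnth P j))) 0 j =
    \sum_(x in cart A) cart_weight A x * (f * g).@[x].
  move=> ->; rewrite -sum_points; apply: eq_bigr => j _.
  by rewrite mul_mx_diag !mxE mevalM mulrC [RHS]mulrC mulrAC.
apply/idP/idP => [/mem_dual_code cdual|/mem_AC_code[f fS cE]]; last first.
  apply/mem_dual_code => _ /mem_AC_code[g gS ->].
  rewrite (pairE f) //; apply: sum_cart_weight_low_degree => t /msuppM_le.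
  move=> /allpairsP[[t1 t2] /= [t1f t2g ->]]; rewrite mdegD.
  have [d1 _] := in_SleP _ _ fS _ t1f.
  have [d2 _] := in_SleP _ _ gS _ t2g.
  by rewrite -ltz_nat PoszD -/k; lia.
have /mem_AC_code[f fS cE] := AC_code_full c.
apply/mem_AC_code; exists f => //.
apply/in_SleP => t tf; split; last by have [] := in_SleP _ _ fS _ tf.
rewrite leNgt; apply/negP => tbig.
(* The leading monomial has maximal degree because the order on monomials
   compares degrees first. *)
set u := mlead f.
have f0 : f != 0 by apply: contraTneq tf => ->; rewrite msupp0.
have umax t' : t' \in msupp f -> (mdeg t' <= mdeg u)%N.
  by move=> /msize_mdeg_lt; rewrite -mlead_deg // ltnS.
have uf : u \in msupp f by apply: mlead_supp.
have [_ uA] := in_SleP _ _ fS _ uf.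
pose v := [multinom (#|A i| - 1 - u i)%N | i < m].
have uv i : (u i + v i = #|A i| - 1)%N.
  by rewrite mnmE subnKC // subn1 -ltnS (leq_trans (uA i)) ?leqSpred.
have deg_uv : (mdeg u + mdeg v = k)%N.
  by rewrite !mdegE -big_split; apply: eq_bigr => i _; apply: uv.
have vd : (mdeg v <= d)%N.
  by have := umax t tf; move: tbig deg_uv; lia.
have vS : in_Sle A d 'X_[v].
  apply/in_SleP => w; rewrite msuppX inE => /eqP ->; split=> // i.
  by rewrite mnmE; apply: leq_ltn_trans (leq_subr _ _) _; rewrite ltn_subrL card_gt0 A0.
have /cdual : eval_word P 'X_[v] \in AC_code A P d by apply/mem_AC_code; exists 'X_[v].
rewrite (pairE f) // (top_degree_pairing A0 uv umax) => /eqP.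
by rewrite mcoeff_eq0 uf.
Qed.

End CodeOfCart.

Theorem corollary5p8 (F : finFieldType) (m : nat) (A : 'I_m -> {set F})
    (A_neq0 : forall i, A i != set0)
    (A_sorted : forall i j : 'I_m, (i <= j)%N -> (#|A i| <= #|A j|)%N)
    (P : #|cart A|.-tuple {ffun 'I_m -> F})
    (P_uniq : uniq P) (P_enum : P =i cart A)
    (d : nat) (d_gt0 : (0 < d)%N) :
  let k := (\sum_(i < m) (#|A i| - 1))%N in
  (d <= k)%N ->
  forall r : nat, (1 <= r <= \dim (dual_code (AC_code A P d%:Z)))%N ->
    ghw r (dual_code (AC_code A P d%:Z)) =
    ghw r (AC_code A P (k%:Z - d%:Z - 1)).
Proof.
move=> k _ r _; apply: ghw_diag => [j|c]; last exact: AC_code_dual.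
by rewrite mxE cart_weight_neq0 // -P_enum mem_tnth.
Qed.
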